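(* Consider the optimal control problem of minimizing $\mathcal{J}(\mathbf{U})=\sum_{t=0}^{T-1}c(\mathbf{x}_t,\mathbf{u}_t)+C_T(\mathbf{x}_T)$ over $\mathbf{U}=(\mathbf{u}_0,\dots,\mathbf{u}_{T-1})\in(\mathbb{R}^m)^T$, subject to $\mathbf{x}_{t+1}=\mathbf{f}(\mathbf{x}_t,\mathbf{u}_t)$ for $t=0,\dots,T-1$, with $\mathbf{x}_0\in\mathbb{R}^n$ given and $T\ge 1$, where $\mathbf{f}:\mathbb{R}^n\times\mathbb{R}^m\to\mathbb{R}^n$, $c:\mathbb{R}^n\times\mathbb{R}^m\to\mathbb{R}$ and $C_T:\mathbb{R}^n\to\mathbb{R}$ are twice continuously differentiable. Let $(\bar{\mathbf{x}}_t,\bar{\mathbf{u}}_t)$ be a nominal trajectory satisfying the dynamics and starting at $\mathbf{x}_0$, and let $\bar{\mathbf{U}}=(\bar{\mathbf{u}}_0,\dots,\bar{\mathbf{u}}_{T-1})$. Assume that, along the nominal trajectory, (i) $c_{\mathbf{u}_t\mathbf{u}_t}\succ 0$ for all $t$; (ii) $C_{T,\mathbf{x}\mathbf{x}}\succeq 0$; (iii) $\begin{bmatrix} c_{\mathbf{x}_t\mathbf{x}_t} & c_{\mathbf{x}_t\mathbf{u}_t}\\ c_{\mathbf{u}_t\mathbf{x}_t} & c_{\mathbf{u}_t\mathbf{u}_t}\end{bmatrix}\succeq 0$ for all $t$. Then the following hold. (a) The solution of the iLQR problem at the nominal trajectory is a descent direction for the cost: if $\delta\mathbf{U}=(\delta\mathbf{u}_0,\dots,\delta\mathbf{u}_{T-1})$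 is the control part of the solution and $\delta\mathbf{U}\neq 0$, then $\frac{d}{d\epsilon}\mathcal{J}(\bar{\mathbf{U}}+\epsilon\,\delta\mathbf{U})\big|_{\epsilon=0}<0$. (b) The next iLQR solution can be made feasible by a suitable line search: there is $\alpha\in(0,1]$ such that the trajectory produced by the iLQR forward pass with line-search parameter $\alpha$ satisfies the dynamics and starts at $\mathbf{x}_0$. (c) In contrast, the solution of the Newton LQR problem need not be a descent direction: there exist problem data, a nominal trajectory satisfying (i)-(iii), and multiplier estimates $\bar{\boldsymbol\lambda}_1,\dots,\bar{\boldsymbol\lambda}_T\in\mathbb{R}^n$ for which the Newton LQR problem has a solution with control part $\delta\mathbf{U}\ne 0$ that does not satisfy $\frac{d}{d\epsilon}\mathcal{J}(\bar{\mathbf{U}}+\epsilon\,\delta\mathbf{U})\big|_{\epsilon=0}<0$.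
   Context: Notation. $\mathbf{f}_{\mathbf{x}_t},\mathbf{f}_{\mathbf{u}_t}$ are the Jacobians of $\mathbf{f}$; $c_{\mathbf{x}_t},c_{\mathbf{u}_t}$ and $c_{\mathbf{x}_t\mathbf{x}_t},c_{\mathbf{x}_t\mathbf{u}_t},c_{\mathbf{u}_t\mathbf{x}_t},c_{\mathbf{u}_t\mathbf{u}_t}$ are the first and second derivatives of $c$, all evaluated at $(\bar{\mathbf{x}}_t,\bar{\mathbf{u}}_t)$. $C_{T,\mathbf{x}},C_{T,\mathbf{x}\mathbf{x}}$ are the gradient and Hessian of $C_T$ at $\bar{\mathbf{x}}_T$. Gradients are treated as columns in the recursions below and as rows in products such as $c_{\mathbf{x}_t}\delta\mathbf{x}_t$. $\mathcal{J}(\mathbf{U})$ is regarded as a function of the controls only, with the states generated from $\mathbf{x}_0$ by the dynamics. $\succ 0$ (resp. $\succeq 0$) means symmetric positive definite (resp. semidefinite). iLQR problem at the nominal trajectory: minimize over $(\delta\mathbf{x}_t,\delta\mathbf{u}_t)$ $$\sum_{t=0}^{T-1}\Big(c_{\mathbf{x}_t}\delta\mathbf{x}_t+c_{\mathbf{u}_t}\delta\mathbf{u}_t+\tfrac12\delta\mathbf{x}_t^\top c_{\mathbf{x}_t\mathbf{x}_t}\delta\mathbf{x}_t+\delta\mathbf{x}_t^\top c_{\mathbf{x}_t\mathbf{u}_t}\delta\mathbf{u}_t+\tfrac12\delta\mathbf{u}_t^\top c_{\mathbf{u}_t\mathbf{u}_t}\delta\mathbf{u}_t\Big)+C_{T,\mathbf{x}}\delta\mathbf{x}_T+\tfrac12\delta\mathbf{x}_T^\top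 C_{T,\mathbf{x}\mathbf{x}}\delta\mathbf{x}_T$$ subject to $\delta\mathbf{x}_{t+1}=\mathbf{f}_{\mathbf{x}_t}\delta\mathbf{x}_t+\mathbf{f}_{\mathbf{u}_t}\delta\mathbf{u}_t$ for $t=0,\dots,T-1$ and $\delta\mathbf{x}_0=0$. It is solved by the backward recursion started at $\mathbf{S}_T=C_{T,\mathbf{x}\mathbf{x}}$, $\mathbf{v}_T=C_{T,\mathbf{x}}$: for $t=T-1,\dots,0$, $Q_{\mathbf{x}}^t=c_{\mathbf{x}_t}+\mathbf{f}_{\mathbf{x}_t}^\top\mathbf{v}_{t+1}$, $Q_{\mathbf{u}}^t=c_{\mathbf{u}_t}+\mathbf{f}_{\mathbf{u}_t}^\top\mathbf{v}_{t+1}$, $Q_{\mathbf{x}\mathbf{x}}^t=c_{\mathbf{x}_t\mathbf{x}_t}+\mathbf{f}_{\mathbf{x}_t}^\top\mathbf{S}_{t+1}\mathbf{f}_{\mathbf{x}_t}$, $Q_{\mathbf{u}\mathbf{u}}^t=c_{\mathbf{u}_t\mathbf{u}_t}+\mathbf{f}_{\mathbf{u}_t}^\top\mathbf{S}_{t+1}\mathbf{f}_{\mathbf{u}_t}$, $Q_{\mathbf{u}\mathbf{x}}^t=(Q_{\mathbf{x}\mathbf{u}}^t)^\top=c_{\mathbf{u}_t\mathbf{x}_t}+\mathbf{f}_{\mathbf{u}_t}^\top\mathbf{S}_{t+1}\mathbf{f}_{\mathbf{x}_t}$, $\mathbf{v}_t=Q_{\mathbf{x}}^t-Q_{\mathbf{x}\mathbf{u}}^t(Q_{\mathbf{u}\mathbf{u}}^t)^{-1}Q_{\mathbf{u}}^t$,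 $\mathbf{S}_t=Q_{\mathbf{x}\mathbf{x}}^t-Q_{\mathbf{x}\mathbf{u}}^t(Q_{\mathbf{u}\mathbf{u}}^t)^{-1}Q_{\mathbf{u}\mathbf{x}}^t$, with gains $\mathbf{k}_t=-(Q_{\mathbf{u}\mathbf{u}}^t)^{-1}Q_{\mathbf{u}}^t$, $\mathbf{K}_t=-(Q_{\mathbf{u}\mathbf{u}}^t)^{-1}Q_{\mathbf{u}\mathbf{x}}^t$. The solution is $\delta\mathbf{u}_t=\mathbf{k}_t+\mathbf{K}_t\delta\mathbf{x}_t$ together with the linearized dynamics. iLQR forward pass with line-search parameter $\alpha\in(0,1]$: starting from $\mathbf{x}_0$, set $\mathbf{u}_t=\bar{\mathbf{u}}_t+\alpha\mathbf{k}_t+\mathbf{K}_t(\mathbf{x}_t-\bar{\mathbf{x}}_t)$ and $\mathbf{x}_{t+1}=\mathbf{f}(\mathbf{x}_t,\mathbf{u}_t)$. Newton LQR problem at the nominal trajectory with multiplier estimates $\bar{\boldsymbol\lambda}_1,\dots,\bar{\boldsymbol\lambda}_T$: the same quadratic program and constraints as the iLQR problem, but with $\sum_{t=0}^{T-1}\frac12 D^2\big[\bar{\boldsymbol\lambda}_{t+1}^\top\mathbf{f}\big](\bar{\mathbf{x}}_t,\bar{\mathbf{u}}_t)\big[(\delta\mathbf{x}_t,\delta\mathbf{u}_t),(\delta\mathbf{x}_t,\delta\mathbf{u}_t)\big]$ added to the objective, where $D^2[\bar{\boldsymbol\lambda}_{t+1}^\top\mathbf{f}]$ is the Hessian of the scalar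 function $(\mathbf{x},\mathbf{u})\mapsto\bar{\boldsymbol\lambda}_{t+1}^\top\mathbf{f}(\mathbf{x},\mathbf{u})$. A ''solution'' of the Newton LQR problem means a point satisfying its first-order necessary (Lagrange/KKT) conditions. *)

(* Defs.v *)
From HB Require Import structures.
From mathcomp Require Import all_boot all_order all_algebra.
From mathcomp Require Import all_classical all_reals all_analysis.

Set Implicit Arguments.
Unset Strict Implicit.
Unset Printing Implicit Defensive.

Import Order.TTheory GRing.Theory Num.Theory.
Import numFieldNormedType.Exports.

Local Open Scope classical_set_scope.
Local Open Scope ring_scope.

(* R^n is 'cV[R]_n, and a function of (x, u) is a function on the product
   normed module 'cV[R]_n * 'cV[R]_m.

   Controls (u_t), t < T, and states (x_t), t <= T, are encoded as functions on
   nat whose entries beyond that range are ignored. *)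

(* On finite-dimensional spaces, pointwise continuity of z |-> Dg(z)[v] for
   every v is continuity of z |-> Dg(z) in operator norm. *)
Definition C1 (R : realType) (V W : normedModType R) (g : V -> W) : Prop :=
  (forall z, differentiable g z) /\ (forall v, continuous ('D_v g)).

Definition C2 (R : realType) (V W : normedModType R) (g : V -> W) : Prop :=
  C1 g /\ (forall v, C1 ('D_v g)).

Definition dotv (R : realType) n (a b : 'cV[R]_n) : R := (a^T *m b) 0 0.

Definition possemidef (R : realType) n (A : 'M[R]_n) : Prop :=
  A^T = A /\ forall z : 'cV[R]_n, 0 <= dotv z (A *m z).

Definition posdef (R : realType) n (A : 'M[R]_n) : Prop :=
  A^T = A /\ forall z : 'cV[R]_n, z != 0 -> 0 < dotv z (A *m z).

Record ocp (R : realType) (n m : nat) := Ocp {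
  horizon : nat;
  dyn : 'cV[R]_n * 'cV[R]_m -> 'cV[R]_n;
  cost : 'cV[R]_n * 'cV[R]_m -> R;
  tcost : 'cV[R]_n -> R;
  init : 'cV[R]_n }.

Definition smooth (R : realType) n m (P : ocp R n m) : Prop :=
  [/\ C2 (dyn P), C2 (cost P) & C2 (tcost P)].

Section Problem.
Context (R : realType) (n m : nat) (P : ocp R n m).
Implicit Types (x : nat -> 'cV[R]_n) (u : nat -> 'cV[R]_m).

Definition trajectory x u : Prop :=
  x 0%N = init P /\
  forall t, (t < horizon P)%N -> x t.+1 = dyn P (x t, u t).

Fixpoint rollout u (t : nat) : 'cV[R]_n :=
  if t is s.+1 then dyn P (rollout u s, u s) else init P.

Definition total_cost u : R :=
  \sum_(0 <= t < horizon P) cost P (rollout u t, u t)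
  + tcost P (rollout u (horizon P)).

Definition cost_along u (du : nat -> 'cV[R]_m) (eps : R) : R :=
  total_cost (fun t => u t + eps *: du t).

Definition nonzero_controls u : Prop :=
  exists t, (t < horizon P)%N /\ u t != 0.

End Problem.

Section AlongNominal.
Context (R : realType) (n m : nat) (P : ocp R n m).
Context (xbar : nat -> 'cV[R]_n) (ubar : nat -> 'cV[R]_m).
Implicit Types (t : nat) (S : 'M[R]_n) (v : 'cV[R]_n).
Implicit Types (dx mu : nat -> 'cV[R]_n) (du : nat -> 'cV[R]_m).

Local Notation T := (horizon P).
Local Notation zbar t := (xbar t, ubar t).

Definition xdir (i : 'I_n) : 'cV[R]_n * 'cV[R]_m := (delta_mx i 0, 0).
Definition udir (j : 'I_m) : 'cV[R]_n * 'cV[R]_m := (0, delta_mx j 0).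

Definition fx t : 'M[R]_n :=
  \matrix_(i, j) ('D_(xdir j) (dyn P) (zbar t)) i 0.
Definition fu t : 'M[R]_(n, m) :=
  \matrix_(i, j) ('D_(udir j) (dyn P) (zbar t)) i 0.

Definition cx t : 'cV[R]_n := \col_i 'D_(xdir i) (cost P) (zbar t).
Definition cu t : 'cV[R]_m := \col_i 'D_(udir i) (cost P) (zbar t).

Definition cxx t : 'M[R]_n :=
  \matrix_(i, j) 'D_(xdir i) ('D_(xdir j) (cost P)) (zbar t).
Definition cxu t : 'M[R]_(n, m) :=
  \matrix_(i, j) 'D_(xdir i) ('D_(udir j) (cost P)) (zbar t).
Definition cux t : 'M[R]_(m, n) :=
  \matrix_(i, j) 'D_(udir i) ('D_(xdir j) (cost P)) (zbar t).
Definition cuu t : 'M[R]_m :=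
  \matrix_(i, j) 'D_(udir i) ('D_(udir j) (cost P)) (zbar t).

Definition CTx : 'cV[R]_n := \col_i 'D_(delta_mx i 0) (tcost P) (xbar T).
Definition CTxx : 'M[R]_n :=
  \matrix_(i, j) 'D_(delta_mx i 0) ('D_(delta_mx j 0) (tcost P)) (xbar T).

Definition convex_along : Prop :=
  [/\ forall t, (t < T)%N -> posdef (cuu t),
      possemidef CTxx
    & forall t, (t < T)%N ->
        possemidef (block_mx (cxx t) (cxu t) (cux t) (cuu t))].

Definition linear_feasible dx du : Prop :=
  dx 0%N = 0 /\
  forall t, (t < T)%N -> dx t.+1 = fx t *m dx t + fu t *m du t.

Definition ilqr_objective dx du : R :=
  \sum_(0 <= t < T)
    (dotv (cx t) (dx t) + dotv (cu t) (du t)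
     + 2^-1 * dotv (dx t) (cxx t *m dx t)
     + dotv (dx t) (cxu t *m du t)
     + 2^-1 * dotv (du t) (cuu t *m du t))
  + dotv CTx (dx T) + 2^-1 * dotv (dx T) (CTxx *m dx T).

Definition ilqr_solution dx du : Prop :=
  linear_feasible dx du /\
  forall dx' du', linear_feasible dx' du' ->
    ilqr_objective dx du <= ilqr_objective dx' du'.

(* In the next five definitions S and v stand for S_(t+1) and v_(t+1). *)
Definition Qx t v : 'cV[R]_n := cx t + (fx t)^T *m v.
Definition Qu t v : 'cV[R]_m := cu t + (fu t)^T *m v.
Definition Qxx t S : 'M[R]_n := cxx t + (fx t)^T *m S *m fx t.
Definition Quu t S : 'M[R]_m := cuu t + (fu t)^T *m S *m fu t.
Definition Qux t S : 'M[R]_(m, n) := cux t + (fu t)^T *m S *m fx t.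

(* [backward k] is the pair (S_(T-k), v_(T-k)). *)
Fixpoint backward (k : nat) : 'M[R]_n * 'cV[R]_n :=
  if k is j.+1 then
    let: (S1, v1) := backward j in
    let t := (T - j.+1)%N in
    let G := (Qux t S1)^T *m invmx (Quu t S1) in
    (Qxx t S1 - G *m Qux t S1, Qx t v1 - G *m Qu t v1)
  else (CTxx, CTx).

Definition Smx t : 'M[R]_n := (backward (T - t)).1.
Definition vvec t : 'cV[R]_n := (backward (T - t)).2.

Definition kff t : 'cV[R]_m :=
  - (invmx (Quu t (Smx t.+1)) *m Qu t (vvec t.+1)).
Definition Kfb t : 'M[R]_(m, n) :=
  - (invmx (Quu t (Smx t.+1)) *m Qux t (Smx t.+1)).

Fixpoint ilqr_dx t : 'cV[R]_n :=
  if t is s.+1 then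
    fx s *m ilqr_dx s + fu s *m (kff s + Kfb s *m ilqr_dx s)
  else 0.
Definition ilqr_du t : 'cV[R]_m := kff t + Kfb t *m ilqr_dx t.

Definition forward_control (alpha : R) t (x : 'cV[R]_n) : 'cV[R]_m :=
  ubar t + alpha *: kff t + Kfb t *m (x - xbar t).

Fixpoint forward_x (alpha : R) t : 'cV[R]_n :=
  if t is s.+1 then
    dyn P (forward_x alpha s, forward_control alpha s (forward_x alpha s))
  else init P.
Definition forward_u (alpha : R) t : 'cV[R]_m :=
  forward_control alpha t (forward_x alpha t).

(* The multiplier estimates lam_1, ..., lam_T are the entries 1, ..., T of [lam]. *)
Definition D2lamf (lam : nat -> 'cV[R]_n) t (w : 'cV[R]_n * 'cV[R]_m) : R :=
  'D_w ('D_w (fun z => dotv (lam t.+1) (dyn P z))) (zbar t).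

Definition newton_objective (lam : nat -> 'cV[R]_n) dx du : R :=
  ilqr_objective dx du
  + \sum_(0 <= t < T) 2^-1 * D2lamf lam t (dx t, du t).

(* [mu 0] is the multiplier of dx_0 = 0, and [mu t.+1] that of the linearized
   dynamics at stage t. *)
Definition newton_lagrangian (lam mu : nat -> 'cV[R]_n) dx du : R :=
  newton_objective lam dx du + dotv (mu 0%N) (dx 0%N)
  + \sum_(0 <= t < T)
      dotv (mu t.+1) (fx t *m dx t + fu t *m du t - dx t.+1).

(* KKT point: feasible, and the differential of the Lagrangian in (dx, du)
   vanishes. *)
Definition newton_solution (lam : nat -> 'cV[R]_n) dx du : Prop :=
  linear_feasible dx du /\
  exists mu : nat -> 'cV[R]_n,
    forall (wx : nat -> 'cV[R]_n) (wu : nat -> 'cV[R]_m),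
      is_derive (0 : R) (1 : R)
        (fun eps : R => newton_lagrangian lam mu
           (fun t => dx t + eps *: wx t) (fun t => du t + eps *: wu t))
        (0 : R).

End AlongNominal.

(* Main.v *)
Require Import Defs.
From HB Require Import structures.
From mathcomp Require Import all_boot all_order all_algebra.
From mathcomp Require Import ring lra.
From mathcomp Require Import all_classical all_reals all_analysis.

(* Completing the square in u turns the Bellman step at stage t into
     stage cost + V_(t+1) = V_t + 1/2 |u - k_t - K_t x|^2_Quu - constant,
   where V_t x = v_t . x + 1/2 x . S_t x. Summing over t, the iLQR objective is
   a constant plus squares that vanish exactly for the backward recursion.

   (a) By the chain rule, the derivative of the cost along du is the linear part
   of the iLQR objective. Comparing an optimal (dx, du) with 0 gives
   linear + quadratic <= 0, and the quadratic part is positive: at the first t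
   with du_t != 0 one has dx_t = 0, so the stage term is 1/2 du_t . cuu du_t.

   (c) For T = n = m = 1, f = u^2, c = u + u^2/2, C_T = 0 at the zero
   trajectory, the multiplier -1 turns the reduced Newton objective into
   u - u^2/2, whose critical point u = 1 is a maximum, whereas dJ/du = 1 at
   u = 0. *)

Set Implicit Arguments.
Unset Strict Implicit.
Unset Printing Implicit Defensive.

Import Order.TTheory GRing.Theory Num.Theory.
Import numFieldNormedType.Exports.

Local Open Scope classical_set_scope.
Local Open Scope ring_scope.

(** * Dot products and definite matrices *)

Section Dot.
Context (R : realType).
Implicit Types (m n : nat).

Lemma dotvE n (a b : 'cV[R]_n) : dotv a b = \sum_i a i 0 * b i 0.
Proof. by rewrite /dotv mxE; apply: eq_bigr => i _; rewrite mxE. Qed.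

Lemma dotvC n (a b : 'cV[R]_n) : dotv a b = dotv b a.
Proof. by rewrite !dotvE; apply: eq_bigr => i _; rewrite mulrC. Qed.

Lemma dotvDr n (a b c : 'cV[R]_n) : dotv a (b + c) = dotv a b + dotv a c.
Proof. by rewrite /dotv mulmxDr mxE. Qed.

Lemma dotvDl n (a b c : 'cV[R]_n) : dotv (a + b) c = dotv a c + dotv b c.
Proof. by rewrite dotvC dotvDr !(dotvC c). Qed.

Lemma dotvZr n k (a b : 'cV[R]_n) : dotv a (k *: b) = k * dotv a b.
Proof. by rewrite /dotv -scalemxAr mxE. Qed.

Lemma dotvZl n k (a b : 'cV[R]_n) : dotv (k *: a) b = k * dotv a b.
Proof. by rewrite dotvC dotvZr dotvC. Qed.

Lemma dotvNr n (a b : 'cV[R]_n) : dotv a (- b) = - dotv a b.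
Proof. by rewrite -scaleN1r dotvZr mulN1r. Qed.

Lemma dotvNl n (a b : 'cV[R]_n) : dotv (- a) b = - dotv a b.
Proof. by rewrite -scaleN1r dotvZl mulN1r. Qed.

Lemma dotv0r n (a : 'cV[R]_n) : dotv a 0 = 0.
Proof. by rewrite -(scale0r 0) dotvZr mul0r. Qed.

Lemma dotv0l n (a : 'cV[R]_n) : dotv 0 a = 0.
Proof. by rewrite dotvC dotv0r. Qed.

Lemma dotv_mulmxr m n (A : 'M[R]_(m, n)) a b :
  dotv a (A *m b) = dotv (A^T *m a) b.
Proof. by rewrite /dotv trmx_mul trmxK mulmxA. Qed.

Lemma dotv_sym n (A : 'M[R]_n) a b :
  A^T = A -> dotv a (A *m b) = dotv b (A *m a).
Proof. by move=> AT; rewrite dotv_mulmxr AT dotvC. Qed.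

(** A row of the left kernel, transposed, is by symmetry a vector [z] with [A z = 0], so
    [z . A z = 0] and definiteness forces [z = 0]. *)
Lemma posdef_unitmx n (A : 'M[R]_n) : posdef A -> A \in unitmx.
Proof.
move=> [AT Apos]; rewrite -row_free_unit -kermx_eq0; apply/eqP/row_matrixP => i.
rewrite row0; apply/eqP; case: eqVneq => // r0.
have /Apos : (row i (kermx A))^T != 0 by rewrite trmx_eq0.
by rewrite -{2}AT -trmx_mul -row_mul mulmx_ker row0 trmx0 dotv0r ltxx.
Qed.

(** The added form is [S] evaluated at [B z]. The sum has the shape of [Quu]. *)
Lemma posdef_semidef_add m n (C : 'M[R]_m) (S : 'M[R]_n) (B : 'M[R]_(n, m)) :
  posdef C -> possemidef S -> posdef (C + B^T *m S *m B).
Proof.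
move=> [CT Cpos] [ST Spos]; split.
  by rewrite linearD /= !trmx_mul trmxK CT ST mulmxA.
move=> z z0; rewrite mulmxDl dotvDr ltr_wpDr ?Cpos//.
by rewrite -!mulmxA dotv_mulmxr trmxK.
Qed.

End Dot.

(** * Completing the square and Schur complements *)

Section CompleteSquare.
Context (R : realType) (n m : nat).

(** The point [y] is stationary for the quadratic on the left, so expanding around it leaves no
    linear term; the last summand is the value at [y]. *)
Lemma quadratic_recenter (Q : 'M[R]_m) (u y w : 'cV[R]_m) :
  Q^T = Q -> Q *m y = - w ->
  dotv u w + 2^-1 * dotv u (Q *m u)
  = 2^-1 * dotv (u - y) (Q *m (u - y)) + 2^-1 * dotv y w.
Proof.
move=> QT Qy; rewrite mulmxBr !(dotvDl, dotvDr, dotvNl, dotvNr).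
by rewrite (dotv_sym y u QT) Qy !dotvNr; field.
Qed.

(** Here [Q] plays the inverse of [Quu]. The left side is twice the value at the stationary control;
    sorted by degree in [x], it yields the corrections to [Qx] and [Qxx] in the backward
    recursion. *)
Lemma quadratic_min_value (Q : 'M[R]_m) (q : 'cV[R]_m) (G : 'M[R]_(m, n)) x :
  Q^T = Q ->
  dotv (- (Q *m q) + (- (Q *m G)) *m x) (q + G *m x)
  = - dotv q (Q *m q) - 2 * dotv (G^T *m Q *m q) x
    - dotv x (G^T *m Q *m G *m x).
Proof.
move=> QT; rewrite mulNmx -!mulmxA !(dotvDl, dotvDr, dotvNl).
rewrite (dotvC (Q *m q)) (dotvC _ x) !(dotv_mulmxr G^T) trmxK.
rewrite (dotvC _ q) (dotv_sym q _ QT) -(dotvC (G *m x)).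
by rewrite (dotvC (Q *m _) (G *m x)); ring.
Qed.

(** The one-stage Bellman identity: the coefficients of [x] on the right are the next [v] and [S] of
    the backward recursion, and [h] is the affine feedback law. *)
Lemma complete_square (A : 'M[R]_n) (B : 'M[R]_(n, m)) (p : 'cV[R]_n)
    (q : 'cV[R]_m) (Cxx : 'M[R]_n) (Cxu : 'M[R]_(n, m)) (Cux : 'M[R]_(m, n))
    (Cuu : 'M[R]_m) (S : 'M[R]_n) (v x : 'cV[R]_n) (u : 'cV[R]_m)
    (Quu := Cuu + B^T *m S *m B) (Qux := Cux + B^T *m S *m A)
    (Qxx := Cxx + A^T *m S *m A) (Qu := q + B^T *m v) (Qx := p + A^T *m v)
    (h := - (invmx Quu *m Qu) + (- (invmx Quu *m Qux)) *m x) :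
  S^T = S -> Cux^T = Cxu -> posdef Quu ->
  dotv p x + dotv q u + 2^-1 * dotv x (Cxx *m x) + dotv x (Cxu *m u)
  + 2^-1 * dotv u (Cuu *m u)
  + (dotv v (A *m x + B *m u)
     + 2^-1 * dotv (A *m x + B *m u) (S *m (A *m x + B *m u)))
  = dotv (Qx - Qux^T *m invmx Quu *m Qu) x
    + 2^-1 * dotv x ((Qxx - Qux^T *m invmx Quu *m Qux) *m x)
    + (2^-1 * dotv (u - h) (Quu *m (u - h))
       - 2^-1 * dotv Qu (invmx Quu *m Qu)).
Proof.
move=> ST CxuE Qpos; have QU := posdef_unitmx Qpos; have [QT _] := Qpos.
have SE : dotv (A *m x + B *m u) (S *m (A *m x + B *m u)) =
    dotv x (A^T *m S *m A *m x) + 2 * dotv u (B^T *m S *m A *m x)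
    + dotv u (B^T *m S *m B *m u).
  rewrite -!mulmxA !(dotv_mulmxr A^T) !(dotv_mulmxr B^T) !trmxK.
  rewrite mulmxDr !(dotvDl, dotvDr) (dotv_sym (A *m x) (B *m u) ST); ring.
(* Substituting the dynamics collects everything into the Q-function of the stage, grouped as a
   quadratic in [u] with [x] fixed. *)
have -> : dotv p x + dotv q u + 2^-1 * dotv x (Cxx *m x) + dotv x (Cxu *m u)
  + 2^-1 * dotv u (Cuu *m u)
  + (dotv v (A *m x + B *m u)
     + 2^-1 * dotv (A *m x + B *m u) (S *m (A *m x + B *m u)))
  = dotv Qx x + 2^-1 * dotv x (Qxx *m x)
    + (dotv u (Qu + Qux *m x) + 2^-1 * dotv u (Quu *m u)).
  rewrite SE /Qx /Qu /Qxx /Qux /Quu -CxuE !mulmxDl !(dotvDl, dotvDr).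
  rewrite (dotv_mulmxr Cux^T) trmxK (dotv_mulmxr A) (dotv_mulmxr B).
  rewrite (dotvC _ u) (dotvC _ u) (dotvC (B^T *m v) u).
  by field.
rewrite (@quadratic_recenter Quu u h (Qu + Qux *m x))//; last first.
  by rewrite /h mulNmx -opprD mulmxN -mulmxA -mulmxDr mulmxA mulmxV ?mul1mx.
rewrite quadratic_min_value ?trmx_inv ?QT// mulmxBl !(dotvDl, dotvNl).
by rewrite dotvDr dotvNr; field.
Qed.

Lemma possemidef_block (Cxx : 'M[R]_n) (Cxu : 'M[R]_(n, m))
    (Cux : 'M[R]_(m, n)) (Cuu : 'M[R]_m) :
  possemidef (block_mx Cxx Cxu Cux Cuu) -> Cxx^T = Cxx /\ Cux^T = Cxu.
Proof. by move=> [+ _]; rewrite tr_block_mx => /eq_block_mx[]. Qed.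

(** This is half the block form at the stacked vector [(x, u)]; the two cross terms agree by
    symmetry of the block matrix. *)
Lemma block_quadratic_ge0 (Cxx : 'M[R]_n) (Cxu : 'M[R]_(n, m))
    (Cux : 'M[R]_(m, n)) (Cuu : 'M[R]_m) x u :
  possemidef (block_mx Cxx Cxu Cux Cuu) ->
  0 <= 2^-1 * dotv x (Cxx *m x) + dotv x (Cxu *m u) + 2^-1 * dotv u (Cuu *m u).
Proof.
move=> Cpos; have [_ CxuT] := possemidef_block Cpos.
have := Cpos.2 (col_mx x u); rewrite mul_block_col /dotv tr_col_mx mul_row_col.
rewrite mxE -!/(dotv _ _) !dotvDr -CxuT (dotv_mulmxr Cux^T) trmxK.
by rewrite (dotvC u (Cux *m x)); lra.
Qed.

(** The Schur complement at [x] is a nonnegative form in [(x, u)] evaluated at the minimizing [u].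
    It propagates semidefiniteness through the backward recursion. *)
Lemma schur_possemidef (A : 'M[R]_n) (B : 'M[R]_(n, m)) (Cxx : 'M[R]_n)
    (Cxu : 'M[R]_(n, m)) (Cux : 'M[R]_(m, n)) (Cuu : 'M[R]_m) (S : 'M[R]_n)
    (Quu := Cuu + B^T *m S *m B) (Qux := Cux + B^T *m S *m A)
    (Qxx := Cxx + A^T *m S *m A) :
  possemidef S -> posdef Cuu -> possemidef (block_mx Cxx Cxu Cux Cuu) ->
  possemidef (Qxx - Qux^T *m invmx Quu *m Qux).
Proof.
move=> Spos Cuupos Cpos.
have Qpos : posdef Quu by exact: posdef_semidef_add.
have [QT _] := Qpos; have [ST S0] := Spos.
have [CxxT CxuT] := possemidef_block Cpos.
split.
  rewrite /Qxx !linearB linearD /= !trmx_mul trmxK trmx_inv QT CxxT ST.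
  by rewrite !mulmxA trmxK.
move=> x; set u := - (invmx Quu *m Qux) *m x.
(* With zero linear data the feedback law is exactly [u], so the square and the constant both
   vanish. *)
have := complete_square A 0 0 Cxx 0 x u ST CxuT Qpos.
rewrite !mulmx0 !addr0 !mulmx0 subr0 oppr0 add0r !dotv0l !add0r.
rewrite -!/Quu -!/Qux -!/Qxx -/u subrr dotv0l mulr0 subr0 addr0 => E.
rewrite -(@pmulr_rge0 _ 2^-1) ?invr_gt0 ?ltr0n// -E.
rewrite addr_ge0 ?mulr_ge0 ?invr_ge0 ?ler0n//.
exact: block_quadratic_ge0 Cpos.
Qed.

End CompleteSquare.

(** * Chain rule along curves and directional derivatives in coordinates *)

Section Derivatives.
Context (R : realType).

Lemma is_derive_comp_diff (V W : normedModType R) (g : V -> W)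
    (phi : R -> V) t w :
  differentiable g (phi t) -> is_derive t (1 : R) phi w ->
  is_derive t (1 : R) (g \o phi) ('D_w g (phi t)).
Proof.
move=> dg [dphi phiw].
have dphi' : differentiable phi t by apply/derivable1_diffP.
have dc : differentiable (g \o phi) t by apply: differentiable_comp.
apply: DeriveDef; first exact/derivable1_diffP.
by rewrite deriveE// diff_comp//= [RHS]deriveE// -phiw deriveE.
Qed.

Lemma is_derive_pair (V W : normedModType R) (f : R -> V) (g : R -> W) t a b :
  is_derive t (1 : R) f a -> is_derive t (1 : R) g b ->
  is_derive t (1 : R) (fun s => (f s, g s)) (a, b).
Proof.
move=> [df fa] [dg gb].
have df' : differentiable f t by apply/derivable1_diffP.
have dg' : differentiable g t by apply/derivable1_diffP.
have dp := differentiable_pair df' dg'.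
apply: DeriveDef; first exact/derivable1_diffP.
by rewrite deriveE// diff_pair//= -fa -gb !deriveE.
Qed.

Lemma derive_col n (V : normedModType R) (g : 'cV[R]_n -> V) z a :
  differentiable g z ->
  'D_a g z = \sum_i a i 0 *: 'D_(delta_mx i 0) g z.
Proof.
move=> dg; rewrite {1}(matrix_sum_delta a) deriveE//.
rewrite linear_sum; apply: eq_bigr => i _.
by rewrite big_ord1 linearZ deriveE.
Qed.

(** Linearity of the differential on the standard basis of the product; this links directional
    derivatives to the coordinate Jacobians and gradients. *)
Lemma derive_pair_col n m (V : normedModType R)
    (g : 'cV[R]_n * 'cV[R]_m -> V) z a b :
  differentiable g z ->
  'D_(a, b) g z = \sum_i a i 0 *: 'D_(xdir R m i) g z
                  + \sum_j b j 0 *: 'D_(udir R n j) g z.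
Proof.
move=> dg; rewrite deriveE//.
have -> : (a, b) = \sum_i a i 0 *: xdir R m i + \sum_j b j 0 *: udir R n j.
  have fstS I (r : seq I) (F : I -> 'cV[R]_n * 'cV[R]_m) :
      \sum_(i <- r) F i = (\sum_(i <- r) (F i).1, \sum_(i <- r) (F i).2).
    by elim/big_rec3: _ => // i x y w _ ->; case: (F i).
  rewrite !fstS /=; congr (_, _).
    rewrite {1}(matrix_sum_delta a) [X in _ = _ + X]big1 ?addr0; last first.
      by move=> i _; rewrite scaler0.
    by apply: eq_bigr => i _; rewrite big_ord1.
  rewrite {1}(matrix_sum_delta b) [X in _ = X + _]big1 ?add0r; last first.
    by move=> i _; rewrite scaler0.
  by apply: eq_bigr => i _; rewrite big_ord1.
rewrite linearD !linear_sum; congr (_ + _);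
  by apply: eq_bigr => i _; rewrite linearZ deriveE.
Qed.

Lemma is_derive_sum_nat (V W : normedModType R) (x v : V) k
    (h : nat -> V -> W) (dh : nat -> W) :
  (forall t, (t < k)%N -> is_derive x v (h t) (dh t)) ->
  is_derive x v (fun e => \sum_(0 <= t < k) h t e) (\sum_(0 <= t < k) dh t).
Proof.
move=> hd; rewrite big_mkord.
rewrite (_ : (fun _ => _) = \sum_(i < k) h i); last first.
  by apply/funext => e; rewrite big_mkord fct_sumE.
by apply: is_derive_sum => i; exact: hd.
Qed.

End Derivatives.

(** * First-order variation of the cost along the nominal trajectory *)

Section Problem.
Context (R : realType) (n m : nat) (P : ocp R n m).
Context (xbar : nat -> 'cV[R]_n) (ubar : nat -> 'cV[R]_m).
Implicit Types (dx : nat -> 'cV[R]_n) (du : nat -> 'cV[R]_m).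
Local Notation T := (horizon P).
Local Notation fx := (fx P xbar ubar).
Local Notation fu := (fu P xbar ubar).
Local Notation cx := (cx P xbar ubar).
Local Notation cu := (cu P xbar ubar).
Local Notation cxx := (cxx P xbar ubar).
Local Notation cxu := (cxu P xbar ubar).
Local Notation cux := (cux P xbar ubar).
Local Notation cuu := (cuu P xbar ubar).
Local Notation CTx := (CTx P xbar).
Local Notation CTxx := (CTxx P xbar).
Local Notation Quu := (Quu P xbar ubar).
Local Notation Qux := (Qux P xbar ubar).
Local Notation Qxx := (Qxx P xbar ubar).
Local Notation Qx := (Qx P xbar ubar).
Local Notation Qu := (Qu P xbar ubar).
Local Notation Smx := (Smx P xbar ubar).
Local Notation vvec := (vvec P xbar ubar).
Local Notation kff := (kff P xbar ubar).
Local Notation Kfb := (Kfb P xbar ubar).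
Local Notation objective := (ilqr_objective P xbar ubar).
Local Notation feasible := (linear_feasible P xbar ubar).

Lemma derive_dyn t a b : differentiable (dyn P) (xbar t, ubar t) ->
  'D_(a, b) (dyn P) (xbar t, ubar t) = fx t *m a + fu t *m b.
Proof.
move=> df; rewrite derive_pair_col//; apply/colP => k.
rewrite !mxE !summxE; congr (_ + _); apply: eq_bigr => i _;
  by rewrite !mxE mulrC.
Qed.

Lemma derive_cost t a b : differentiable (cost P) (xbar t, ubar t) ->
  'D_(a, b) (cost P) (xbar t, ubar t) = dotv (cx t) a + dotv (cu t) b.
Proof.
move=> df; rewrite derive_pair_col// !dotvE.
by congr (_ + _); apply: eq_bigr => i _; rewrite !mxE mulrC.
Qed.

Lemma derive_tcost a : differentiable (tcost P) (xbar T) ->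
  'D_a (tcost P) (xbar T) = dotv CTx a.
Proof.
move=> df; rewrite derive_col// !dotvE.
by apply: eq_bigr => i _; rewrite !mxE mulrC.
Qed.

Lemma rollout_nominal : trajectory P xbar ubar ->
  forall t, (t <= T)%N -> rollout P ubar t = xbar t.
Proof.
move=> [x0 xS]; elim=> [|t IH] tT /=; first by rewrite x0.
by rewrite IH ?xS// ltnW.
Qed.

Lemma is_derive_perturb t du :
  is_derive (0 : R) (1 : R) (fun e : R => ubar t + e *: du t) (du t).
Proof.
have de : is_derive (0 : R) (1 : R) (fun e : R => e *: du t) (du t).
  have df : differentiable (fun e : R => e *: du t) (0 : R) by [].
  apply: DeriveDef; first exact/derivable1_diffP.
  by rewrite deriveE// diff_val scale1r.
have := is_deriveD (is_derive_cst (ubar t) (0 : R) (1 : R)) de.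
by rewrite add0r.
Qed.

(** Differentiating the dynamics in the perturbation size gives the linearized dynamics, so the
    feasible [dx] is the state sensitivity; induction on the stage. *)
Lemma is_derive_rollout dx du : (forall z, differentiable (dyn P) z) ->
  trajectory P xbar ubar -> feasible dx du ->
  forall t, (t <= T)%N ->
  is_derive (0 : R) (1 : R)
    (fun e : R => rollout P (fun s => ubar s + e *: du s) t) (dx t).
Proof.
move=> df traj [dx0 dxS]; elim=> [|t IH] tT.
  by rewrite dx0; exact: is_derive_cst.
(* The chain rule evaluates derivatives at the rollout with zero perturbation, which must be
   identified with the nominal point. *)
have xu0 : (rollout P (fun s => ubar s + 0 *: du s) t, ubar t + 0 *: du t)
    = (xbar t, ubar t).
  rewrite scale0r addr0 -(rollout_nominal traj (ltnW tT)).
  by congr (rollout _ _ _, _); apply/funext => s; rewrite scale0r addr0.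
have dp := is_derive_pair (IH (ltnW tT)) (is_derive_perturb t du).
have := is_derive_comp_diff (df _) dp.
by rewrite xu0 derive_dyn// dxS.
Qed.

Definition linear_part dx du : R :=
  \sum_(0 <= t < T) (dotv (cx t) (dx t) + dotv (cu t) (du t))
  + dotv CTx (dx T).

Lemma is_derive_cost_along dx du : smooth P ->
  trajectory P xbar ubar -> feasible dx du ->
  is_derive (0 : R) (1 : R) (cost_along P ubar du) (linear_part dx du).
Proof.
move=> [[[df _] _] [[dc _] _] [[dC _] _]] traj feas.
have dr := is_derive_rollout df traj feas.
have r0 t : (t <= T)%N ->
    rollout P (fun s => ubar s + 0 *: du s) t = xbar t.
  move=> tT; rewrite -(rollout_nominal traj tT).
  by congr rollout; apply/funext => s; rewrite scale0r addr0.
have dsum : is_derive (0 : R) (1 : R) (fun e => \sum_(0 <= t < T)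
    cost P (rollout P (fun s => ubar s + e *: du s) t, ubar t + e *: du t))
    (\sum_(0 <= t < T) (dotv (cx t) (dx t) + dotv (cu t) (du t))).
  apply: is_derive_sum_nat => t tT.
  have := is_derive_comp_diff (dc _)
    (is_derive_pair (dr t (ltnW tT)) (is_derive_perturb t du)).
  by rewrite r0 ?(ltnW tT)// scale0r addr0 derive_cost.
have dterm := is_derive_comp_diff (dC _) (dr T (leqnn T)).
rewrite r0// derive_tcost// in dterm.
exact: is_deriveD dsum dterm.
Qed.

(** * Positivity of the quadratic part and the descent property *)

Definition quadratic_stage dx du t : R :=
  2^-1 * dotv (dx t) (cxx t *m dx t) + dotv (dx t) (cxu t *m du t)
  + 2^-1 * dotv (du t) (cuu t *m du t).

Definition quadratic_part dx du : R :=
  \sum_(0 <= t < T) quadratic_stage dx du t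
  + 2^-1 * dotv (dx T) (CTxx *m dx T).

Lemma ilqr_objectiveE dx du :
  objective dx du = linear_part dx du + quadratic_part dx du.
Proof.
rewrite /ilqr_objective /linear_part /quadratic_part addrACA -big_split /=.
rewrite addrA.
by congr (_ + _ + _); apply: eq_bigr => t _; rewrite /quadratic_stage !addrA.
Qed.

Lemma quadratic_stage_ge0 dx du t : convex_along P xbar ubar -> (t < T)%N ->
  0 <= quadratic_stage dx du t.
Proof.
move=> [_ _ Cpos] tT; exact: block_quadratic_ge0 (Cpos t tT).
Qed.

Lemma quadratic_part_gt0 dx du : convex_along P xbar ubar ->
  feasible dx du -> nonzero_controls P du -> 0 < quadratic_part dx du.
Proof.
move=> conv [dx0 dxS] nzdu; have [cuupos [_ CTpos] _] := conv.
have nzdu' : exists t, (t < T)%N && (du t != 0).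
  by have [t [tT dut]] := nzdu; exists t; rewrite tT.
case: (ex_minnP nzdu') => t0 /andP[t0T dut0] t0min.
(* All controls before the first nonzero one vanish, so the linearized state stays at its initial
   value 0 up to and including stage [t0]. *)
have dxt0 t : (t <= t0)%N -> dx t = 0.
  elim: t => // t IH tt0; rewrite dxS ?(ltn_trans tt0)//.
  rewrite IH ?(ltnW tt0)// mulmx0 add0r.
  case: (eqVneq (du t) 0) => [->|dut]; first by rewrite mulmx0.
  by have := t0min t; rewrite (ltn_trans tt0)// dut leqNgt tt0 => /(_ isT).
(* Stage [t0] is split off as the strictly positive term; the other stages and the terminal term are
   nonnegative. *)
rewrite ltr_pwDl ?mulr_ge0 ?invr_ge0// big_mkord (bigD1 (Ordinal t0T))//=.
rewrite ltr_pwDl ?sumr_ge0//; last by move=> i _; exact: quadratic_stage_ge0.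
rewrite /quadratic_stage dxt0// !dotv0l mulr0 !add0r mulr_gt0 ?invr_gt0//.
exact: (cuupos _ t0T).2.
Qed.

(** The comparison with the zero perturbation applies to any minimizer, not just the one built by
    the recursion. *)
Lemma ilqr_solution_descent dx du : convex_along P xbar ubar ->
  ilqr_solution P xbar ubar dx du -> nonzero_controls P du ->
  linear_part dx du < 0.
Proof.
move=> conv [feas opt] nz.
have feas0 : feasible (fun=> 0) (fun=> 0).
  by split=> // t _; rewrite !mulmx0 addr0.
have := opt _ _ feas0; rewrite !ilqr_objectiveE.
have -> : linear_part (fun=> 0) (fun=> 0) = 0.
  by rewrite /linear_part big1 ?dotv0r ?addr0// => t _; rewrite !dotv0r addr0.
have -> : quadratic_part (fun=> 0) (fun=> 0) = 0.
  rewrite /quadratic_part big1 ?dotv0l ?mulr0 ?addr0// => t _.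
  by rewrite /quadratic_stage !dotv0l mulr0 !addr0.
by have := quadratic_part_gt0 conv feas nz; lra.
Qed.

(** * The Riccati recursion and optimality of its feedback law *)

Lemma SmxT : Smx T = CTxx. Proof. by rewrite /Smx subnn. Qed.
Lemma vvecT : vvec T = CTx. Proof. by rewrite /vvec subnn. Qed.

Lemma riccati t : (t < T)%N ->
  let G := (Qux t (Smx t.+1))^T *m invmx (Quu t (Smx t.+1)) in
  Smx t = Qxx t (Smx t.+1) - G *m Qux t (Smx t.+1) /\
  vvec t = Qx t (vvec t.+1) - G *m Qu t (vvec t.+1).
Proof.
move=> tT G.
(* [backward] counts stages from the end; this is the time it assigns to the step that produces
   stage [t]. *)
have e : (T - (T - t.+1).+1)%N = t by rewrite subnSK// subKn// ltnW.
rewrite /G /Smx /vvec -(subnSK tT) /= e.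
by case: (backward _ _ _ _) => S v /=; split; reflexivity.
Qed.

Lemma Smx_possemidef t : convex_along P xbar ubar -> (t <= T)%N ->
  possemidef (Smx t).
Proof.
(* Writing [t] as [T - (T - t)] turns backward induction in time into induction on the number of
   remaining stages. *)
move=> [cuupos CTpos Cpos]; move/subKn <-.
elim: (T - t)%N (leq_subr t T) => [|k IH] kT; first by rewrite subn0 SmxT.
have tT : (T - k.+1 < T)%N by rewrite ltn_subrL (leq_trans _ kT).
rewrite (riccati tT).1 subnSK//.
by apply: schur_possemidef (IH _) (cuupos _ tT) (Cpos _ tT); exact: ltnW.
Qed.

(** This makes the [invmx] in the gains a genuine inverse; on a singular matrix [invmx] returns its
    argument. *)
Lemma Quu_posdef t : convex_along P xbar ubar -> (t < T)%N ->
  posdef (Quu t (Smx t.+1)).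
Proof.
move=> conv tT; have [cuupos _ _] := conv.
exact: posdef_semidef_add (cuupos _ tT) (Smx_possemidef conv tT).
Qed.

Definition control_gap dx du t : R :=
  let e := du t - (kff t + Kfb t *m dx t) in
  2^-1 * dotv e (Quu t (Smx t.+1) *m e).

(** The decrease gained by the feedforward term at stage [t]; under convexity, the optimal iLQR
    value is minus the sum of these. *)
Definition value_drop t : R :=
  2^-1 * dotv (Qu t (vvec t.+1))
              (invmx (Quu t (Smx t.+1)) *m Qu t (vvec t.+1)).

Lemma objective_gap dx du : convex_along P xbar ubar -> feasible dx du ->
  objective dx du = \sum_(0 <= t < T) (control_gap dx du t - value_drop t).
Proof.
move=> conv [dx0 dxS]; have [_ _ Cpos] := conv.
pose V t := dotv (vvec t) (dx t) + 2^-1 * dotv (dx t) (Smx t *m dx t).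
rewrite /ilqr_objective -addrA -SmxT -vvecT -/(V T).
(* Since [dx 0 = 0] gives [V 0 = 0], the terminal cost telescopes and is distributed over the
   stages, where the Bellman identity applies. *)
have -> : V T = \sum_(0 <= t < T) (V t.+1 - V t).
  by rewrite telescope_sumr// /V dx0 dotv0r dotv0l mulr0 addr0 subr0.
rewrite -big_split /=; apply: eq_big_nat => t /andP[_ tT].
have [_ CxuT] := possemidef_block (Cpos t tT).
have ST := (Smx_possemidef conv tT).1.
have := complete_square (fx t) (cx t) (cu t) (cxx t) (vvec t.+1) (dx t) (du t)
  ST CxuT (Quu_posdef conv tT).
rewrite -!/(Quu _ _) -!/(Qux _ _) -!/(Qxx _ _) -!/(Qx _ _) -!/(Qu _ _).
rewrite -(riccati tT).1 -(riccati tT).2 -dxS// -/(kff t) -/(Kfb t).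
rewrite -/(V t) -/(V t.+1) -/(value_drop t) -/(control_gap dx du t).
by lra.
Qed.

Lemma ilqr_backward_solution : convex_along P xbar ubar ->
  ilqr_solution P xbar ubar (ilqr_dx P xbar ubar) (ilqr_du P xbar ubar).
Proof.
move=> conv; have feas : feasible (ilqr_dx P xbar ubar) (ilqr_du P xbar ubar).
  by split.
split=> // dx du feas'; rewrite !objective_gap//.
(* Stage by stage the constants cancel, the gap of the recursion's own control is 0, and any other
   gap is nonnegative. *)
apply: ler_sum_nat => t /andP[_ tT].
rewrite lerD2r /control_gap subrr dotv0l mulr0.
rewrite mulr_ge0 ?invr_ge0//.
set e := _ - _; have [->|e0] := eqVneq e 0; first by rewrite dotv0l.
exact/ltW/(Quu_posdef conv tT).2.
Qed.

(** The forward pass rolls out the nonlinear dynamics itself, so feasibility holds by computation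
    for every [alpha]. *)
Lemma forward_trajectory alpha :
  trajectory P (forward_x P xbar ubar alpha) (forward_u P xbar ubar alpha).
Proof. by []. Qed.

End Problem.

(** * Quadratic functions of one linear form *)

Section Quadratics.
Context (R : realType).

(** A continuous linear map is its own differential; the linear structure is packed on the fly from
    the bare proof. *)
Lemma is_diff_linear (V : normedModType R) (l : V -> R) (z : V) :
  linear l -> continuous l -> is_diff z l l.
Proof.
move=> lin lc; pose M := GRing.isLinear.Build _ _ _ _ _ lin.
pose L : {linear V -> R} := HB.pack l M.
apply: DiffDef; first exact: (@linear_differentiable _ _ _ L).
exact: (@diff_lin _ _ _ L).
Qed.

(* A family closed under directional derivatives, so that C2 and all the second
   derivatives of the counterexample come from one formula. *)
Definition quad (V W : normedModType R) (l : V -> R) (e : W)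
    (c a b : R) (z : V) : W :=
  (c + a * l z + b * l z ^+ 2) *: e.

Lemma is_diff_quad (V W : normedModType R) (l : V -> R) (e : W) c a b z :
  is_diff z l l ->
  is_diff z (quad l e c a b)
    (fun v => ((a + 2 * b * l z) * l v) *: e).
Proof.
move=> dl.
(* In this combinator form, instance resolution computes the differential. *)
have -> : quad l e c a b = *:%R ^~ e \o (cst c + a *: l + b *: (l ^+ 2)).
  by apply/funext => y.
apply: is_diff_eq; apply/funext => v /=.
rewrite !fctE/=; congr (_ *: _).
by rewrite -[LHS]/(0 + a * l v + b * (2%:R * (l z) ^+ 1 * l v)); ring.
Qed.

Lemma derive_quad (V W : normedModType R) (l : V -> R) (e : W) c a b v :
  (forall z, is_diff z l l) ->
  'D_v (quad l e c a b) = quad l e (a * l v) (2 * b * l v) 0.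
Proof.
move=> dl; apply/funext => z; have dq := is_diff_quad e c a b (dl z).
rewrite deriveE// diff_val /quad; congr (_ *: _); ring.
Qed.

Lemma derive_quadE (V W : normedModType R) (l : V -> R) (e : W) c a b v z :
  (forall z, is_diff z l l) ->
  'D_v (quad l e c a b) z = quad l e (a * l v) (2 * b * l v) 0 z.
Proof. by move=> dl; rewrite -(derive_quad e c a b v dl). Qed.

Lemma C1_quad (V W : normedModType R) (l : V -> R) (e : W) c a b :
  (forall z, is_diff z l l) -> C1 (quad l e c a b).
Proof.
move=> dl; split=> [z|v z]; first by have := is_diff_quad e c a b (dl z).
rewrite derive_quad//; apply: differentiable_continuous.
by have := is_diff_quad e (a * l v) (2 * b * l v) 0 (dl z).
Qed.

Lemma C2_quad (V W : normedModType R) (l : V -> R) (e : W) c a b :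
  (forall z, is_diff z l l) -> C2 (quad l e c a b).
Proof.
by move=> dl; split=> [|v]; rewrite ?derive_quad//; exact: C1_quad.
Qed.

End Quadratics.

(** * A Newton LQR solution that is an ascent direction *)

Section Counterexample.
Context (R : realType).

Definition xcoord (x : 'cV[R]_1) : R := x 0 0.
Definition ucoord (z : 'cV[R]_1 * 'cV[R]_1) : R := z.2 0 0.

#[local] Instance is_diff_xcoord x : is_diff x xcoord xcoord.
Proof.
apply: is_diff_linear; last exact: coord_continuous.
by move=> k a b; rewrite /xcoord !mxE.
Qed.

#[local] Instance is_diff_ucoord z : is_diff z ucoord ucoord.
Proof.
apply: is_diff_linear; first by move=> k a b; rewrite /ucoord !mxE.
move=> y; apply: (@continuous_comp _ _ _ snd xcoord); first exact: cvg_snd.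
exact: coord_continuous.
Qed.

(** The dynamics have zero Jacobian but nonzero curvature at the origin, so a multiplier changes
    only the second-order term of the Newton problem. The zero terminal cost is also written with
    [quad], so the same lemmas cover it. *)
Definition ascent_ocp : ocp R 1 1 :=
  Ocp 1 (quad ucoord (const_mx 1) 0 0 1) (quad ucoord (1 : R) 0 1 2^-1)
    (quad xcoord (1 : R) 0 0 0) 0.

Let zero : nat -> 'cV[R]_1 := fun=> 0.
Let lam : nat -> 'cV[R]_1 := fun=> const_mx (-1).
Let du : nat -> 'cV[R]_1 := fun=> const_mx 1.

Lemma ascent_smooth : smooth ascent_ocp.
Proof. by split; exact: C2_quad. Qed.

Lemma ascent_fx t : fx ascent_ocp zero zero t = 0.
Proof.
apply/matrixP => i j; rewrite !mxE/= derive_quadE.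
by rewrite /quad /ucoord/= !mxE/=; ring.
Qed.

Lemma ascent_fu t : fu ascent_ocp zero zero t = 0.
Proof.
apply/matrixP => i j; rewrite !mxE/= derive_quadE.
by rewrite /quad /ucoord/= !mxE/=; ring.
Qed.

Lemma ascent_cx t : cx ascent_ocp zero zero t = 0.
Proof.
apply/matrixP => i j; rewrite !mxE/= derive_quadE.
by rewrite /quad /ucoord/= !mxE/= scaler1; ring.
Qed.

Lemma ascent_cu t : cu ascent_ocp zero zero t = const_mx 1.
Proof.
apply/matrixP => i j; rewrite !mxE/= derive_quadE.
by rewrite /quad /ucoord/= !mxE/= !ord1 scaler1 eqxx/=; field.
Qed.

Lemma ascent_cxx t : cxx ascent_ocp zero zero t = 0.
Proof.
apply/matrixP => i j; rewrite !mxE/= ?derive_quad ?derive_quadE.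
by rewrite /quad /ucoord/= !mxE/= scaler1; ring.
Qed.

Lemma ascent_cxu t : cxu ascent_ocp zero zero t = 0.
Proof.
apply/matrixP => i j; rewrite !mxE/= ?derive_quad ?derive_quadE.
by rewrite /quad /ucoord/= !mxE/= scaler1; ring.
Qed.

Lemma ascent_cux t : cux ascent_ocp zero zero t = 0.
Proof.
apply/matrixP => i j; rewrite !mxE/= ?derive_quad ?derive_quadE.
by rewrite /quad /ucoord/= !mxE/= scaler1; ring.
Qed.

Lemma ascent_cuu t : cuu ascent_ocp zero zero t = 1%:M.
Proof.
apply/matrixP => i j; rewrite !mxE/= ?derive_quad ?derive_quadE.
by rewrite /quad /ucoord/= !mxE/= !ord1 scaler1 eqxx/=; field.
Qed.

Lemma ascent_CTx : CTx ascent_ocp zero = 0.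
Proof.
apply/matrixP => i j; rewrite !mxE/= ?derive_quad ?derive_quadE.
by rewrite /quad scaler1; ring.
Qed.

Lemma ascent_CTxx : CTxx ascent_ocp zero = 0.
Proof.
apply/matrixP => i j; rewrite !mxE/= ?derive_quad ?derive_quadE.
by rewrite /quad scaler1; ring.
Qed.

Lemma ascent_trajectory : trajectory ascent_ocp zero zero.
Proof.
split=> // t _ /=; rewrite /quad /ucoord/= mxE.
by rewrite -[LHS](scale0r (const_mx 1)); congr (_ *: _); ring.
Qed.

Lemma dotv11 (a b : 'cV[R]_1) : dotv a b = a 0 0 * b 0 0.
Proof. by rewrite dotvE big_ord1. Qed.

Lemma ascent_convex : convex_along ascent_ocp zero zero.
Proof.
split=> [t _||t _].
- rewrite ascent_cuu; split; first by rewrite trmx1.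
  move=> z z0; rewrite mul1mx dotv11 -expr2 exprn_even_gt0//=.
  by apply: contra_neq z0 => z00; apply/matrixP => i j; rewrite !ord1 mxE.
- by rewrite ascent_CTxx; split=> [|z]; rewrite ?trmx0// mul0mx dotv0r.
- rewrite ascent_cxx ascent_cxu ascent_cux ascent_cuu.
  split=> [|z]; first by rewrite tr_block_mx !trmx0 trmx1.
  rewrite -[z]vsubmxK mul_block_col !mul0mx mul1mx !add0r.
  rewrite /dotv tr_col_mx mul_row_col mulmx0 add0r -/(dotv _ _) dotv11.
  by rewrite -expr2 sqr_ge0.
Qed.

Lemma ascent_feasible : linear_feasible ascent_ocp zero zero zero du.
Proof. by split=> // t _; rewrite ascent_fx ascent_fu !mul0mx addr0. Qed.

(** The multiplier -1 contributes [- u^2] to the iLQR objective [u + u^2 / 2]; the state does not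
    enter. *)
Lemma ascent_newton_objective dx (v : nat -> 'cV[R]_1) :
  newton_objective ascent_ocp zero zero lam dx v
  = v 0%N 0 0 - 2^-1 * v 0%N 0 0 ^+ 2.
Proof.
rewrite /newton_objective /ilqr_objective !big_nat1.
rewrite ascent_cx ascent_cu ascent_cxx ascent_cxu ascent_cuu.
rewrite ascent_CTx ascent_CTxx.
rewrite !mul0mx mul1mx !(dotv0l, dotv0r) !dotv11 mxE /D2lamf.
rewrite (_ : (fun z => dotv _ _) = quad ucoord (-1 : R) 0 0 1); last first.
  by apply/funext => z; rewrite dotv11 /= /quad !mxE/= mulr1 mulrC.
rewrite ?derive_quad ?derive_quadE.
by rewrite /quad /ucoord/= /GRing.scale/=; field.
Qed.

Lemma ascent_newton_solution : newton_solution ascent_ocp zero zero lam zero du.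
Proof.
split; first exact: ascent_feasible.
(* Zero multipliers suffice because the objective is stationary without the constraints: at
   [u = 1 + e w] it equals [1/2 - e^2 w^2 / 2], with no linear term in [e]. *)
exists zero => wx wu; pose k := - 2^-1 * (wu 0%N 0 0) ^+ 2.
rewrite (_ : (fun _ => _) = quad (id : R -> R) (1 : R) 2^-1 0 k); last first.
  apply/funext => e; rewrite /newton_lagrangian ascent_newton_objective.
  by rewrite big_nat1 !dotv0l !addr0 !mxE /quad /k /GRing.scale/=; field.
have dq := is_diff_quad (l := id : R -> R) (1 : R) 2^-1 0 k (is_diff_id 0).
apply: DeriveDef; first exact: diff_derivable.
by rewrite deriveE// diff_val mulr0 addr0 mul0r scale0r.
Qed.

(** With zero Jacobians and zero terminal cost the slope is the control gradient times the unit
    control, which is 1. Derivability is stated too because [derive1] is total and says nothing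
    without it. *)
Lemma newton_not_descent :
  derivable (cost_along ascent_ocp zero du) 0 1 /\
  ~ (derive1 (cost_along ascent_ocp zero du) 0 < 0).
Proof.
have [dJ EJ] := is_derive_cost_along ascent_smooth ascent_trajectory
  ascent_feasible.
split=> //; rewrite derive1E EJ /linear_part big_nat1.
rewrite ascent_cx ascent_cu ascent_CTx !dotv0l dotv11 !mxE add0r addr0 mulr1.
by rewrite ltr10.
Qed.

End Counterexample.

Theorem proposition2 (R : realType) :
  (forall (n m : nat) (P : ocp R n m)
      (xbar : nat -> 'cV[R]_n) (ubar : nat -> 'cV[R]_m),
    (0 < horizon P)%N -> smooth P ->
    trajectory P xbar ubar -> convex_along P xbar ubar ->
    [/\ (* the backward recursion solves the iLQR problem *)
        ilqr_solution P xbar ubar (ilqr_dx P xbar ubar) (ilqr_du P xbar ubar),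
        (* (a) *)
        (forall (dx : nat -> 'cV[R]_n) (du : nat -> 'cV[R]_m),
          ilqr_solution P xbar ubar dx du -> nonzero_controls P du ->
          derivable (cost_along P ubar du) 0 1 /\
          derive1 (cost_along P ubar du) 0 < 0)
      & (* (b) *)
        (exists alpha : R, (0 < alpha /\ alpha <= 1) /\
          trajectory P (forward_x P xbar ubar alpha)
                       (forward_u P xbar ubar alpha))]) /\
  (* (c) *)
  (exists (n m : nat) (P : ocp R n m)
      (xbar : nat -> 'cV[R]_n) (ubar : nat -> 'cV[R]_m)
      (lam : nat -> 'cV[R]_n)
      (dx : nat -> 'cV[R]_n) (du : nat -> 'cV[R]_m),
    [/\ (0 < horizon P)%N /\ smooth P,
        trajectory P xbar ubar /\ convex_along P xbar ubar,
        newton_solution P xbar ubar lam dx du,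
        nonzero_controls P du
      & derivable (cost_along P ubar du) 0 1 /\
        ~ (derive1 (cost_along P ubar du) 0 < 0)]).
Proof.
split=> [n m P xbar ubar _ smoothP traj conv|].
  split; first exact: ilqr_backward_solution.
    move=> dx du sol nz.
    have [dJ EJ] := is_derive_cost_along smoothP traj sol.1.
    by split=> //; rewrite derive1E EJ; exact: ilqr_solution_descent.
  (* The full step is chosen; every [alpha] gives a feasible trajectory. *)
  exists 1; split; first by rewrite ltr01 lexx.
  exact: forward_trajectory.
exists 1%N, 1%N, (ascent_ocp R), (fun=> 0), (fun=> 0), (fun=> const_mx (-1)).
exists (fun=> 0), (fun=> const_mx 1); split.
- by split=> //; exact: ascent_smooth.
- by split; [exact: ascent_trajectory|exact: ascent_convex].
- exact: ascent_newton_solution.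
- exists 0%N; split=> //; apply/eqP => /matrixP/(_ 0 0).
  by rewrite !mxE => /eqP; rewrite oner_eq0.
- exact: newton_not_descent.
Qed.
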